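(* Let $\Omega:\mathbb{R}^n\setminus\{0\}\to\mathbb{R}$ be a measurable function, integrable on $\mathbb{S}^{n-1}$, such that (1) $\Omega(\lambda x)=\Omega(x)$ for all $\lambda>0$ and $x\in\mathbb{R}^n\setminus\{0\}$; (2) $\int_{\mathbb{S}^{n-1}}\Omega(\theta)\,d\sigma(\theta)=0$; (3) there is a constant $C>0$ such that for all $0<\delta<\frac1n$, $$\sup_{|\xi|=1}\int_{\mathbb{S}^{n-1}}|\Omega(\theta)-\Omega(\theta+\delta\xi)|\,d\sigma(\theta)\le Cn\delta\int_{\mathbb{S}^{n-1}}|\Omega(\theta)|\,d\sigma(\theta).$$ Then $\Omega$ satisfies the $L^1$-Dini condition.
   Context: $\mathbb{S}^{n-1}$ is the unit sphere of $\mathbb{R}^n$ and $\sigma$ is its surface (area) measure. $L^1$-Dini condition: a function $\Omega$ on $\mathbb{R}^n\setminus\{0\}$ that is homogeneous of degree zero satisfies the $L^1$-Dini condition if (i) $\Omega\in L^1(\mathbb{S}^{n-1})$, and (ii) $\int_0^1\frac{\omega_1(\delta)}{\delta}\,d\delta<\infty$, where $$\omega_1(\delta)=\sup_{\|\rho\|\le\delta}\int_{\mathbb{S}^{n-1}}|\Omega(\rho\theta)-\Omega(\theta)|\,d\sigma(\theta),$$ the supremum being over rotations $\rho$ of $\mathbb{R}^n$ with $\|\rho\|:=\sup\{|\rho x'-x'|:x'\in\mathbb{S}^{n-1}\}\le\delta$. *)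

(* Defs.v *)
From HB Require Import structures.
From mathcomp Require Import all_boot all_order all_algebra.
From mathcomp Require Import all_classical all_reals all_analysis.
From mathcomp Require Import measurable_realfun.
Import Order.TTheory GRing.Theory Num.Theory.
Import numFieldNormedType.Exports.

Set Implicit Arguments.
Unset Strict Implicit.
Unset Printing Implicit Defensive.

Local Open Scope classical_set_scope.
Local Open Scope ring_scope.

Lemma sigma_finite_product d1 d2 (T1 : measurableType d1)
    (T2 : measurableType d2) (R : realType)
    (m1 : {sigma_finite_measure set T1 -> \bar R})
    (m2 : {sigma_finite_measure set T2 -> \bar R}) :
  sigma_finite setT (m1 \x m2)%E.
Proof.
have /sigma_finiteP[F [TF ndF Foo]] := sigma_finiteT m1.
have /sigma_finiteP[G [TG ndG Goo]] := sigma_finiteT m2.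
exists (fun n => F n `*` G n).
  rewrite -setXTT TF TG predeqE => -[x y]; split.
    move=> [/= [n _ Fnx] [k _ Gky]]; exists (maxn n k) => //; split.
    - by move: x Fnx; exact/subsetPset/ndF/leq_maxl.
    - by move: y Gky; exact/subsetPset/ndG/leq_maxr.
  by move=> [n _ []/= ? ?]; split; exists n.
move=> k; have [? ?] := Foo k; have [? ?] := Goo k.
split; first exact: measurableX.
by rewrite product_measure1E// lte_mul_pinfty// ge0_fin_numE.
Qed.

(* The Borel sigma-algebra of R^n: the one generated by the coordinates. *)
Section rV_measurable.
Context {R : realType} (n : nat).

Let coords (i : 'I_n) (x : 'rV[R]_n) : R := x ord0 i.

Definition rV_display : measure_display.
Proof. exact. Qed.

Let rV_set0 : g_sigma_preimage coords set0.
Proof. exact: sigma_algebra0. Qed.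

Let rV_setC A : g_sigma_preimage coords A -> g_sigma_preimage coords (~` A).
Proof. exact: sigma_algebraC. Qed.

Let rV_bigcup (F : _^nat) : (forall i, g_sigma_preimage coords (F i)) ->
  g_sigma_preimage coords (\bigcup_i (F i)).
Proof. exact: sigma_algebra_bigcup. Qed.

HB.instance Definition _ := @isMeasurable.Build rV_display
  'rV[R]_n (g_sigma_preimage coords) rV_set0 rV_setC rV_bigcup.

Lemma measurable_coord (i : 'I_n) :
  measurable_fun [set: 'rV[R]_n] (fun x : 'rV[R]_n => x ord0 i).
Proof.
move=> _ Y mY; rewrite setTI; apply: sub_sigma_algebra => /=.
rewrite -bigcup_seq/=; exists i => /=; first by rewrite mem_index_enum.
by exists Y => //; rewrite setTI.
Qed.

Lemma measurable_fun_rV d (T : measurableType d) (f : T -> 'rV[R]_n) :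
  (forall i, measurable_fun [set: T] (fun t => f t ord0 i)) ->
  measurable_fun [set: T] f.
Proof.
move=> mf _ A mA; rewrite setTI.
suff: g_sigma_preimage (fun i : 'I_n => coords i \o f) `<=` measurable.
  by apply; rewrite g_sigma_preimage_comp; exists A => //; rewrite setTI.
apply: smallest_sub; first exact: sigma_algebra_measurable.
by rewrite -bigcup_seq/= => B [i _ [C mC <-]]; exact: mf.
Qed.

End rV_measurable.

(* Lebesgue measure on the Borel sets of R^n, as an iterated product. *)
Section lebesgue_rV_borel.
Context {R : realType}.

Definition consrV n (p : R * 'rV[R]_n) : 'rV[R]_n.+1 :=
  row_mx (p.1)%:M p.2.

Lemma measurable_consrV n : measurable_fun [set: R * 'rV[R]_n] (@consrV n).
Proof.
apply: measurable_fun_rV => i; rewrite /consrV.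
have [j ij|j ij] := @split_ordP 1 n i; rewrite ij.
  under eq_fun do rewrite (@row_mxEl _ 1 1 n) (ord1 j) mxE mulr1n.
  exact: measurable_fst.
under eq_fun do rewrite (@row_mxEr _ 1 1 n).
exact: measurableT_comp (measurable_coord j) measurable_snd.
Qed.

Definition lebesgue_cons n (mu : {sigma_finite_measure set 'rV[R]_n -> \bar R})
    (A : set 'rV[R]_n.+1) : \bar R :=
  (lebesgue_measure \x mu)%E (@consrV n @^-1` A).

Section lebesgue_cons_measure.
Context n (mu : {sigma_finite_measure set 'rV[R]_n -> \bar R}).

Let lebesgue_cons0 : lebesgue_cons mu set0 = 0%E.
Proof. by rewrite /lebesgue_cons preimage_set0 measure0. Qed.

Let lebesgue_cons_ge0 A : (0 <= lebesgue_cons mu A)%E.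
Proof. exact: measure_ge0. Qed.

Let measurable_preimage_consrV (A : set 'rV[R]_n.+1) :
  measurable A -> measurable (@consrV n @^-1` A).
Proof. by move=> mA; rewrite -[X in measurable X]setTI; exact: measurable_consrV. Qed.

Let lebesgue_cons_sigma_additive : semi_sigma_additive (lebesgue_cons mu).
Proof.
move=> F mF tF mUF; rewrite /lebesgue_cons preimage_bigcup.
apply: measure_semi_sigma_additive.
- by move=> k; exact: measurable_preimage_consrV.
- apply/trivIsetP => /= i j _ _ ij; rewrite -preimage_setI.
  by move/trivIsetP : tF => /(_ _ _ _ _ ij) ->//; rewrite preimage_set0.
- by rewrite -preimage_bigcup; exact: measurable_preimage_consrV.
Qed.

HB.instance Definition _ := isMeasure.Build _ _ _ (lebesgue_cons mu)
  lebesgue_cons0 lebesgue_cons_ge0 lebesgue_cons_sigma_additive.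

Let unconsrV (x : 'rV[R]_n.+1) : R * 'rV[R]_n :=
  (x ord0 ord0, @rsubmx R 1 1 n x).

Let consrVK : cancel (@consrV n) unconsrV.
Proof.
move=> [a v]; rewrite /unconsrV /consrV/= row_mxKr; congr pair.
have -> : ord0 = @lshift 1 n ord0 :> 'I_n.+1 by exact/val_inj.
by rewrite (@row_mxEl _ 1 1 n) mxE eqxx mulr1n.
Qed.

Let measurable_unconsrV : measurable_fun [set: 'rV[R]_n.+1] unconsrV.
Proof.
apply/measurable_fun_pairP; split; first exact: measurable_coord.
apply: measurable_fun_rV => i /=.
under eq_fun do rewrite mxE.
exact: (@measurable_coord R n.+1 (@rshift 1 n i)).
Qed.

Let lebesgue_cons_sigma_finite : sigma_finite setT (lebesgue_cons mu).
Proof.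
have [F UF mF] := sigma_finite_product lebesgue_measure mu.
exists (fun k => unconsrV @^-1` F k).
  by rewrite -preimage_bigcup -UF preimage_setT.
move=> k; have [mFk Fk] := mF k; split.
  by rewrite -[X in measurable X]setTI; exact: measurable_unconsrV.
rewrite /lebesgue_cons -comp_preimage (_ : _ \o _ = id)//.
by apply/funext => p; exact: consrVK.
Qed.

HB.instance Definition _ := Measure_isSigmaFinite.Build _ _ _ (lebesgue_cons mu)
  lebesgue_cons_sigma_finite.

End lebesgue_cons_measure.

Fixpoint lebesgue_rV_borel n : {sigma_finite_measure set 'rV[R]_n -> \bar R} :=
  match n with
  | 0 => \d_(0 : 'rV[R]_0)
  | m.+1 => lebesgue_cons (lebesgue_rV_borel m)
  end.

(* Measurability for the Lebesgue (i.e. Caratheodory) sigma-algebra of R^n,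
   the completion of the Borel one. *)
Definition lebesgue_measurable_fun n (D : set 'rV[R]_n) (f : 'rV[R]_n -> R) :
    Prop :=
  measurable_fun (D : set (caratheodory_type (lebesgue_rV_borel n)^*%mu)) f.

End lebesgue_rV_borel.

Section euclidean.
Context {R : realType} (n : nat).
Implicit Types x : 'rV[R]_n.

(* `|x| on 'rV[R]_n is the sup norm, hence a separate Euclidean norm. *)
Definition enorm x : R := Num.sqrt (\sum_(i < n) x ord0 i ^+ 2).

Definition unit_sphere : set 'rV[R]_n := [set x | enorm x = 1].

Definition normalize x : 'rV[R]_n := (enorm x)^-1 *: x.

(* Truncated cone over a subset A of the sphere. *)
Definition cone (A : set 'rV[R]_n) : set 'rV[R]_n :=
  [set x | 0 < enorm x <= 1 /\ A (normalize x)].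

Let measurable_sqr_norm :
  measurable_fun [set: 'rV[R]_n] (fun x => \sum_(i < n) x ord0 i ^+ 2).
Proof.
apply: measurable_sum => i; apply: measurable_funX; exact: measurable_coord.
Qed.

Lemma measurable_enorm : measurable_fun [set: 'rV[R]_n] enorm.
Proof.
apply: measurableT_comp measurable_sqr_norm.
by apply: continuous_measurable_fun; exact: sqrt_continuous.
Qed.

Lemma measurable_normalize : measurable_fun [set: 'rV[R]_n] normalize.
Proof.
apply: measurable_fun_rV => i; rewrite /normalize/=.
under eq_fun do rewrite mxE.
apply: measurable_funM; last exact: measurable_coord.
have -> : (fun x => (enorm x)^-1) =
    (fun x => (\sum_(i < n) x ord0 i ^+ 2) `^ (- 2^-1)).
  apply/funext => x; rewrite powRN powR12_sqrt//.
  by apply: sumr_ge0 => j _; exact: sqr_ge0.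
exact: (measurableT_comp (measurable_powR _) measurable_sqr_norm).
Qed.

Lemma measurable_cone (A : set 'rV[R]_n) : measurable A -> measurable (cone A).
Proof.
move=> mA; rewrite (_ : cone A = enorm @^-1` `]0, 1] `&` normalize @^-1` A).
  apply: measurableI; rewrite -[X in measurable X]setTI.
    exact: measurable_enorm.
  exact: measurable_normalize.
by apply/seteqP; split=> x; rewrite /cone/= in_itv/=.
Qed.

(* Surface measure of a Borel set: n times the volume of the cone over it,
   i.e. the measure for which polar coordinates
   dx = r^(n-1) dr dsigma hold. Only A `&` sphere matters. *)
Definition surface_borel (A : set 'rV[R]_n) : \bar R :=
  (n%:R%:E * lebesgue_rV_borel n (cone A))%E.

Let surface_borel0 : surface_borel set0 = 0%E.
Proof.
rewrite /surface_borel (_ : cone set0 = set0) ?measure0 ?mule0//.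
by apply/seteqP; split=> x //= [].
Qed.

Let surface_borel_ge0 A : (0 <= surface_borel A)%E.
Proof. by rewrite mule_ge0// lee_fin. Qed.

Let surface_borel_sigma_additive : semi_sigma_additive surface_borel.
Proof.
move=> F mF tF mUF; rewrite /surface_borel.
under eq_fun do rewrite -ge0_sume_distrr//.
apply: cvgeZl => //.
have -> : cone (\bigcup_k F k) = \bigcup_k cone (F k).
  apply/seteqP; split=> [x [x1 [k _ Fkx]]|x [k _ [x1 Fkx]]].
    by exists k.
  by split=> //; exists k.
apply: measure_semi_sigma_additive.
- by move=> k; exact: measurable_cone.
- apply/trivIsetP => /= i j _ _ ij; apply/seteqP; split=> // x [[_ Fix] [_ Fjx]].
  move/trivIsetP : tF => /(_ _ _ I I ij)/seteqP[+ _].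
  by move/(_ (normalize x)); apply.
- by apply: bigcup_measurable => k _; exact: measurable_cone.
Qed.

HB.instance Definition _ := isMeasure.Build _ _ _ surface_borel
  surface_borel0 surface_borel_ge0 surface_borel_sigma_additive.

Definition surface_measure := @completed_measure_extension _ _ _ surface_borel.

HB.instance Definition _ := Measure.on surface_measure.

End euclidean.

Arguments unit_sphere {R} n _.
Arguments surface_borel {R} n _.
Arguments surface_measure {R} n _.

Section L1_dini.
Context {R : realType} (n : nat).
Local Open Scope ereal_scope.

(* Vectors are rows, so a matrix acts on the right. *)
Definition rotation (rho : 'M[R]_n) : Prop :=
  rho *m rho^T = 1%:M /\ \det rho = 1%R.

Definition rotation_norm (rho : 'M[R]_n) : \bar R :=
  ereal_sup [set (enorm (x *m rho - x)%R)%:E | x in unit_sphere n].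

Definition l1_modulus (Omega : 'rV[R]_n -> R) (delta : R) : \bar R :=
  ereal_sup [set \int[surface_measure n]_(theta in unit_sphere n)
                   `|Omega (theta *m rho) - Omega theta|%R%:E
            | rho in [set rho | rotation rho /\ rotation_norm rho <= delta%:E]].

Definition l1_dini (Omega : 'rV[R]_n -> R) : Prop :=
  (surface_measure n).-integrable (unit_sphere n) (EFin \o Omega) /\
  \int[lebesgue_measure]_(delta in `]0%R, 1%R[)
     (l1_modulus Omega delta * (delta^-1)%:E) < +oo.

End L1_dini.

(* Main.v *)
(* Fix a rotation rho with |x rho - x| <= r on the sphere and a small ball B(0, r).
   For z = x rho + w with |w| < r,
     |Omega (x rho) - Omega x| <= |Omega (x rho) - Omega z| + |Omega z - Omega x|,
   where z - x rho and z - x have length < 2 r. Averaging over w and exchanging the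
   integrals, rotation invariance of sigma and hypothesis (3) give
   int |Omega (x rho) - Omega x| = O(r), since |B(0, 2 r)| / |B(0, r)| does not depend
   on r. Hence omega_1(r) = O(r), while omega_1 <= 2 ||Omega||_1 always, so
   omega_1(r) / r is bounded on ]0, 1[.
   Invariance of Lebesgue measure under rotations follows from its translation
   invariance and uniqueness of Haar measure, the unit ball fixing the constant.
   For Tonelli's theorem, Omega is replaced by a Borel function, homogeneous of
   degree 0, equal to it off the cone over a sigma-null Borel set; hypothesis (3)
   then survives for almost every translation. *)
Require Import Defs.
From HB Require Import structures.
From mathcomp Require Import all_boot all_order all_algebra.
From mathcomp Require Import all_classical all_reals all_analysis.
From mathcomp Require Import measurable_realfun ring lra.
Import Order.TTheory GRing.Theory Num.Theory.
Import numFieldNormedType.Exports.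

Local Open Scope classical_set_scope.
Local Open Scope ring_scope.

(** * Translation invariance of Lebesgue measure *)

Lemma measurable_preimage d1 d2 (T1 : measurableType d1)
    (T2 : measurableType d2) (f : T1 -> T2) (A : set T2) :
  measurable_fun setT f -> measurable A -> measurable (f @^-1` A).
Proof. by move=> mf mA; rewrite -[X in measurable X]setTI; exact: mf. Qed.

(** Lebesgue measure is determined by its values on the intervals []b, c]], and its pushforward
    under a translation has the same values there. *)
Lemma lebesgue_measure_shift (R : realType) (a : R) (A : set R) :
  measurable A -> lebesgue_measure ((fun t => t + a) @^-1` A) = lebesgue_measure A.
Proof.
move=> mA.
have mf : measurable_fun [set: measurableTypeR R]
  ((fun t : R => t + a) : measurableTypeR R -> measurableTypeR R).
  exact: measurable_funD.
apply/esym.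
rewrite (@lebesgue_measure_unique R (pushforward (@lebesgue_measure R)
  ((fun t : R => t + a) : measurableTypeR R -> measurableTypeR R)))//.
move=> _ [[b c]] _ <-.
rewrite -[RHS]/(lebesgue_measure ((fun t : R => t + a) @^-1` `]b, c])).
have -> : (fun t : R => t + a) @^-1` `]b, c] = `]b - a, c - a]%classic.
  by apply/seteqP; split => t; rewrite /= !in_itv/= ltrBlDr lerBrDr.
rewrite !lebesgue_measure_itv/= !lte_fin ltrD2r.
by case: ifP => // _; rewrite -!EFinD; congr EFin; rewrite opprB addrA subrK.
Qed.

Section lebesgue_rV_translation.
Context {R : realType}.

Lemma measurable_fun_addV n d (T : measurableType d) (f g : T -> 'rV[R]_n) :
  measurable_fun setT f -> measurable_fun setT g ->
  measurable_fun setT (fun x => f x + g x).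
Proof.
move=> mf mg; apply: measurable_fun_rV => i; under eq_fun do rewrite mxE.
by apply: measurable_funD; apply: measurableT_comp (measurable_coord i) _.
Qed.

Lemma measurable_addV n (a : 'rV[R]_n) : measurable_fun setT (fun x : 'rV[R]_n => x + a).
Proof. by apply: measurable_fun_addV => //; exact: measurable_cst. Qed.

(** Induction on the dimension: through [consrV], a translation acts separately on the first
    coordinate and on the remaining ones, and a product measure is determined by its values on
    rectangles. In dimension 0 there is a single point. *)
Lemma lebesgue_rV_shift n (a : 'rV[R]_n) (A : set 'rV[R]_n) : measurable A ->
  lebesgue_rV_borel n ((fun x => x + a) @^-1` A) = lebesgue_rV_borel n A.
Proof.
elim: n a A => [|n IH] a A mA.
  rewrite (_ : _ @^-1` _ = A)//; apply/funext => x.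
  by rewrite /preimage/= [_ + _]thinmx0 [x in RHS]thinmx0.
rewrite /= /lebesgue_cons.
pose a0 := a ord0 ord0; pose a' := @rsubmx R 1 1 n a.
pose f : measurableTypeR R * 'rV[R]_n -> measurableTypeR R * 'rV[R]_n :=
  fun p => (p.1 + a0, p.2 + a').
have mf : measurable_fun setT f.
  apply/measurable_fun_pairP; split.
    by apply: measurable_funD => //; exact: measurable_fst.
  exact: measurableT_comp (measurable_addV _ a') measurable_snd.
have -> : consrV (n:=n) @^-1` ((fun x : 'rV_n.+1 => x + a) @^-1` A) =
   f @^-1` (consrV (n:=n) @^-1` A).
  apply/funext => -[t v]; rewrite /preimage /consrV/=; congr A.
  rewrite -[a in LHS](@hsubmxK _ 1 1 n); apply: etrans (@add_row_mx _ 1 1 n _ _ _ _) _.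
  congr row_mx; rewrite raddfD/=; congr (_ + _); apply/matrixP => i j.
  rewrite !mxE !ord1 eqxx mulr1n; congr (a _ _); exact/val_inj.
apply/esym.
rewrite (@product_measure_unique _ _ _ _ R lebesgue_measure (lebesgue_rV_borel n)
  (pushforward (lebesgue_measure \x lebesgue_rV_borel n)%E f))//.
  move=> B C mB mC.
  transitivity ((lebesgue_measure \x lebesgue_rV_borel n)%E
    (((fun t : R => t + a0) @^-1` B) `*` ((fun x => x + a') @^-1` C))) => //.
  rewrite product_measure1E//; last 2 first.
  - by apply: measurable_preimage => //; exact: measurable_funD.
  - by apply: measurable_preimage => //; exact: measurable_addV.
  by rewrite IH//; congr (_ * _)%E; exact: lebesgue_measure_shift.
exact: measurable_preimage (@measurable_consrV _ _) mA.
Qed.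

End lebesgue_rV_translation.

(** * Uniqueness of Haar measure, as an identity between products of volumes *)

Lemma product_measureC d1 d2 (T1 : measurableType d1) (T2 : measurableType d2)
    (R : realType) (m1 : {sigma_finite_measure set T1 -> \bar R})
    (m2 : {sigma_finite_measure set T2 -> \bar R}) (E : set (T1 * T2)) :
  measurable E ->
  (\int[m1]_x m2 (xsection E x) = \int[m2]_y m1 (ysection E y))%E.
Proof.
move=> mE; rewrite -/((m1 \x m2)%E E) -/((m1 \x^ m2)%E E).
apply: (@product_measure_unique _ _ _ _ R m1 m2 (m1 \x^ m2)%E) => // A B mA mB.
exact: (@product_measure2E _ _ _ _ R m1 m2).
Qed.

Lemma integral_two_valued d (T : measurableType d) (R : realType)
    (mu : {measure set T -> \bar R}) (c : \bar R) (A : set T) (F : T -> \bar R) :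
  measurable A -> (forall x, A x -> F x = c) -> (forall x, ~ A x -> F x = 0%E) ->
  (\int[mu]_x F x = c * mu A)%E.
Proof.
move=> mA F1 F0; rewrite -integral_cst// [RHS]integral_mkcond.
apply: eq_integral => x _; rewrite patchE.
by case: ifPn => [/set_mem/F1//|/negP Ax]; apply: F0 => /mem_set.
Qed.

Section haar_uniqueness.
Context {R : realType} (n : nat).
Local Notation lam := (lebesgue_rV_borel n : {sigma_finite_measure set 'rV[R]_n -> \bar R}).
Local Open Scope ereal_scope.

Lemma measurable_fun_mulmx m (M : 'M[R]_(m, n)) :
  measurable_fun setT (mulmx^~ M : 'rV[R]_m -> 'rV[R]_n).
Proof.
apply: measurable_fun_rV => i; under eq_fun do rewrite mxE.
apply: measurable_sum => j; apply: measurable_funM => //; exact: measurable_coord.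
Qed.

(* Both sides are the measure of the pairs (x, y) such that f x is in A and f x + y
   in B, sliced along x and along y. *)
Lemma lebesgue_rV_additive_iso (f g : 'rV[R]_n -> 'rV[R]_n) (A B : set 'rV[R]_n) :
  measurable_fun setT f -> measurable_fun setT g ->
  cancel g f -> {morph f : x y / (x + y)%R} ->
  measurable A -> measurable B -> (forall x, A (- x)%R <-> A x) ->
  lam B * lam (f @^-1` A) = lam A * lam (f @^-1` B).
Proof.
move=> mf mg gK fD mA mB AN.
have fN x : f (- x)%R = (- f x)%R.
  by apply/eqP; rewrite -addr_eq0 -fD addNr -(addrK (f 0%R) (f 0%R)) -fD addr0 subrr.
pose E := [set p : 'rV[R]_n * 'rV[R]_n | A (f p.1) /\ B (f p.1 + p.2)%R].
pose E' := [set p : 'rV[R]_n * 'rV[R]_n | A (f p.1 - p.2)%R /\ B (f p.1)].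
have mf1 : measurable_fun setT (fun p : 'rV[R]_n * 'rV[R]_n => f p.1).
  exact: measurableT_comp mf measurable_fst.
have mN : measurable_fun setT (fun p : 'rV[R]_n * 'rV[R]_n => - p.2)%R.
  apply: measurable_fun_rV => i; under eq_fun do rewrite mxE.
  apply: measurableT_comp => //.
  exact: measurableT_comp (measurable_coord i) measurable_snd.
have mE : measurable E.
  apply: measurableI; apply: measurable_preimage => //.
  by apply: measurable_fun_addV => //; exact: measurable_snd.
have mE' : measurable E'.
  apply: measurableI; apply: measurable_preimage => //.
  exact: measurable_fun_addV.
transitivity (\int[lam]_x lam (xsection E x)).
  rewrite (@integral_two_valued _ _ _ lam (lam B) (f @^-1` A))//.
  - exact: measurable_preimage.
  - move=> x Ax; rewrite -[RHS](lebesgue_rV_shift _ (f x)) //; congr (lam _).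
    apply/seteqP; split => y; rewrite /xsection/= in_setE /E /=.
    + by rewrite addrC => -[].
    + by rewrite addrC.
  - move=> x Ax; rewrite (_ : xsection _ _ = set0) ?measure0//.
    by apply/seteqP; split => y //; rewrite /xsection/= in_setE => -[/Ax].
rewrite product_measureC//.
transitivity (\int[lam]_y lam (ysection E' y)).
  apply: eq_integral => y _.
  (* Since [f (x - g y) = f x - y], translating the slice of [E] at [y] by [- g y] gives the slice
     of [E']. *)
  rewrite -[LHS](lebesgue_rV_shift _ (- g y)%R) //; last exact: measurable_ysection.
  congr (lam _); apply/seteqP; split => x; rewrite /ysection/= !in_setE /E /E' /=.
    by rewrite fD fN gK subrK.
  by rewrite fD fN gK subrK.
rewrite -product_measureC//.
rewrite (@integral_two_valued _ _ _ lam (lam A) (f @^-1` B))//.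
- exact: measurable_preimage.
(* The slice of [E'] at [x] consists of the [y] with [f x - y] in [A]; by the symmetry of [A] it is
   the translate of [A] by [f x]. *)
- move=> x Bx; rewrite -[RHS](lebesgue_rV_shift _ (- f x)%R) //; congr (lam _).
  apply/seteqP; split => y; rewrite /xsection/= in_setE /E' /=.
  + by move=> [+ _]; rewrite -AN opprB addrC.
  + by rewrite -AN opprB addrC.
- move=> x Bx; rewrite (_ : xsection _ _ = set0) ?measure0//.
  by apply/seteqP; split => y //; rewrite /xsection/= in_setE => -[_ /Bx].
Qed.

End haar_uniqueness.

(** * Euclidean norm, balls and cubes *)

Definition eball {R : realType} n (r : R) : set 'rV[R]_n := [set x | enorm x < r].

(** Cubes are rectangles for the iterated product, so their volume is explicit; they bound the
    volume of balls from both sides. *)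
Definition cube {R : realType} n (r : R) : set 'rV[R]_n :=
  [set x | forall i, - r < x ord0 i < r].

Lemma measurable_cube (R : realType) n (r : R) : measurable (cube n r).
Proof.
rewrite (_ : cube n r =
    \bigcap_(i in [set` index_enum 'I_n])
      ((fun x : 'rV[R]_n => x ord0 i) @^-1` `]- r, r[)).
  rewrite bigcap_seq; apply: bigsetI_measurable => i _.
  exact: measurable_preimage (measurable_coord i) _.
apply/seteqP; split=> [x xr i _|x xr i]; rewrite /= ?in_itv//=.
by have := xr i (mem_index_enum i); rewrite /= in_itv.
Qed.

Lemma lebesgue_cube (R : realType) n (r : R) : 0 < r ->
  lebesgue_rV_borel n (cube n r) = ((2 * r) ^+ n)%:E.
Proof.
move=> r0; elim: n => [|n IH].
  by rewrite /= diracE mem_set//= => -[].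
rewrite /= /lebesgue_cons.
rewrite (_ : _ @^-1` _ = `]- r, r[%classic `*` cube n r).
  rewrite product_measure1E//; last exact: measurable_cube.
  rewrite IH/=; transitivity ((2 * r)%:E * ((2 * r) ^+ n)%:E)%E; last by rewrite exprS.
  congr (_ * _)%E; rewrite lebesgue_measure_itv/= lte_fin gtrN// -EFinD.
  by congr EFin; ring.
apply/seteqP; split=> [[t v]|[t v] [/=]].
  rewrite /consrV /= => tv; split => /=.
    have := tv (@lshift 1 n ord0); rewrite (@row_mxEl _ 1 1 n) mxE eqxx.
    by rewrite in_itv.
  by move=> i; have := tv (@rshift 1 n i); rewrite (@row_mxEr _ 1 1 n).
rewrite in_itv/= => tr vr i; rewrite /consrV/=.
have [j ij|j ij] := @split_ordP 1 n i; rewrite ij.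
  by rewrite (@row_mxEl _ 1 1 n) (ord1 j) mxE mulr1n.
by rewrite (@row_mxEr _ 1 1 n).
Qed.

Section enorm_theory.
Context {R : realType} (n : nat).
Implicit Types x y : 'rV[R]_n.

Lemma enorm_ge0 x : 0 <= enorm x. Proof. exact: sqrtr_ge0. Qed.

Lemma sqr_enorm x : enorm x ^+ 2 = \sum_(i < n) x ord0 i ^+ 2.
Proof. by rewrite sqr_sqrtr// sumr_ge0// => i _; exact: sqr_ge0. Qed.

Lemma enormZ (t : R) x : enorm (t *: x) = `|t| * enorm x.
Proof.
rewrite /enorm -sqrtr_sqr -sqrtrM ?sqr_ge0// mulr_sumr.
by congr Num.sqrt; apply: eq_bigr => i _; rewrite mxE exprMn.
Qed.

Lemma enormN x : enorm (- x) = enorm x.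
Proof. by rewrite -scaleN1r enormZ normrN1 mul1r. Qed.

Lemma le_coord_enorm x i : `|x ord0 i| <= enorm x.
Proof.
rewrite -ler_sqr ?nnegrE ?enorm_ge0// sqr_enorm (bigD1 i)//= real_normK ?num_real//.
by rewrite lerDl sumr_ge0// => j _; exact: sqr_ge0.
Qed.

Lemma enorm_gt0 x : (0 < enorm x) = (x != 0).
Proof.
rewrite lt_neqAle enorm_ge0 andbT eq_sym; congr negb.
apply/eqP/eqP => [x0|->]; last by rewrite -(scale0r 0) enormZ normr0 mul0r.
apply/rowP => i; rewrite mxE; apply/eqP; rewrite -normr_le0 -x0.
exact: le_coord_enorm.
Qed.

Lemma enorm_normalize x : x != 0 -> enorm (normalize x) = 1.
Proof.
move=> x0; rewrite /normalize enormZ ger0_norm ?invr_ge0 ?enorm_ge0//.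
by rewrite mulVf// gt_eqF// enorm_gt0.
Qed.

Lemma normalizeZ (t : R) x : 0 < t -> normalize (t *: x) = normalize x.
Proof.
move=> t0; rewrite /normalize enormZ gtr0_norm// scalerA invfM mulrAC.
by rewrite mulVf ?gt_eqF// mul1r.
Qed.

Lemma normalize_sphere x : unit_sphere n x -> normalize x = x.
Proof. by rewrite /unit_sphere/= /normalize => ->; rewrite invr1 scale1r. Qed.

Lemma unit_sphere_neq0 x : unit_sphere n x -> x != 0.
Proof. by rewrite /unit_sphere/= -enorm_gt0 => ->. Qed.

Lemma sqr_enormD_le x y :
  enorm (x + y) ^+ 2 <= 2 * (enorm x ^+ 2 + enorm y ^+ 2).
Proof.
rewrite !sqr_enorm -big_split/= mulr_sumr; apply: ler_sum => i _; rewrite mxE.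
have := sqr_ge0 (x ord0 i - y ord0 i); nra.
Qed.

(* This instance of the triangle inequality needs no Cauchy-Schwarz. *)
Lemma enormD_lt2 x y (d : R) : enorm x <= d -> enorm y < d -> enorm (x + y) < 2 * d.
Proof.
move=> xd yd.
have x0 := enorm_ge0 x; have y0 := enorm_ge0 y.
rewrite -ltr_sqr ?nnegrE ?enorm_ge0//; last by lra.
apply: (le_lt_trans (sqr_enormD_le x y)); nra.
Qed.

Lemma enorm_rotation (rho : 'M[R]_n) x : rotation rho -> enorm (x *m rho) = enorm x.
Proof.
move=> [rr _].
have dot y : \sum_(i < n) y ord0 i ^+ 2 = (y *m y^T) ord0 ord0.
  by rewrite mxE; apply: eq_bigr => i _; rewrite mxE expr2.
rewrite /enorm !dot trmx_mul mulmxA -(mulmxA x) rr mulmx1//.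
Qed.

Lemma measurable_eball (r : R) : measurable (eball n r).
Proof.
rewrite (_ : eball n r = @enorm R n @^-1` `]-oo, r[).
  by apply: measurable_preimage => //; exact: measurable_enorm.
by apply/seteqP; split => x; rewrite /eball/= in_itv.
Qed.

Lemma measurable_unit_sphere : measurable (unit_sphere n : set 'rV[R]_n).
Proof.
rewrite (_ : unit_sphere n = @enorm R n @^-1` [set 1]) //.
by apply: measurable_preimage => //; exact: measurable_enorm.
Qed.

Lemma measurable_scaleV (t : R) : measurable_fun setT (fun x : 'rV[R]_n => t *: x).
Proof.
apply: measurable_fun_rV => i; under eq_fun do rewrite mxE.
apply: measurable_funM => //; exact: measurable_coord.
Qed.

Lemma eball_sub_cube (r : R) : eball n r `<=` cube n r.
Proof. by move=> x xr i; rewrite -ltr_norml (le_lt_trans (le_coord_enorm x i)). Qed.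

Lemma cube_sub_eball (r : R) : (0 < n)%N -> cube n (r / n%:R) `<=` eball n r.
Proof.
move=> n0 x xr.
have n0R : 0 < n%:R :> R by rewrite ltr0n.
(* As [n > 0], some coordinate of [x] lies in []- r / n, r / n[], which is therefore nonempty. *)
have r0 : 0 < r.
  have /andP[h1 h2] := xr (Ordinal n0).
  have : 0 < r / n%:R by lra.
  by rewrite pmulr_lgt0// invr_gt0.
rewrite /eball/= -ltr_sqr ?nnegrE ?enorm_ge0 ?(ltW r0)// sqr_enorm.
(* The [n] squares sum to less than [n (r / n)^2 = r^2 / n], which is at most [r^2]. *)
apply: (@lt_le_trans _ _ (\sum_(i < n) (r / n%:R) ^+ 2)).
  apply: ltr_sum; first by apply/hasP; exists (Ordinal n0); rewrite ?mem_index_enum.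
  move=> i _; rewrite -real_normK ?num_real// ltr_sqr ?nnegrE// ?ltr_norml//.
  by rewrite divr_ge0 ?ltW.
rewrite sumr_const card_ord -[leLHS]mulr_natr.
have -> : (r / n%:R) ^+ 2 * n%:R = r ^+ 2 / n%:R by field; rewrite gt_eqF.
by rewrite ler_pdivrMr// ler_peMr ?exprn_ge0 ?(ltW r0)// ler1n.
Qed.

End enorm_theory.

(** * Volume of balls; dilations and rotations *)

Section lebesgue_eball.
Context {R : realType} (n : nat).
Local Notation lam := (lebesgue_rV_borel n : {sigma_finite_measure set 'rV[R]_n -> \bar R}).
Local Open Scope ereal_scope.

Lemma lebesgue_eball_gt0 (r : R) : (0 < n)%N -> (0 < r)%R -> 0 < lam (eball n r).
Proof.
move=> n0 r0; have rn : (0 < r / n%:R)%R by rewrite divr_gt0// ltr0n.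
apply: (@lt_le_trans _ _ (lam (cube n (r / n%:R)))).
  by rewrite lebesgue_cube// lte_fin exprn_gt0// mulr_gt0.
apply: le_measure; rewrite ?inE.
- exact: measurable_cube.
- exact: measurable_eball.
- exact: cube_sub_eball.
Qed.

Lemma lebesgue_eball_fin (r : R) : (0 < r)%R -> lam (eball n r) \is a fin_num.
Proof.
move=> r0; rewrite ge0_fin_numE//; apply: (@le_lt_trans _ _ (lam (cube n r))).
  apply: le_measure; rewrite ?inE.
  - exact: measurable_eball.
  - exact: measurable_cube.
  - exact: eball_sub_cube.
by rewrite lebesgue_cube// ltry.
Qed.

(** The Haar identity for the dilation by [r^-1], applied to the balls of radius 1 and [s]. With
    [s = 2] it makes [|B(0, 2 r)| / |B(0, r)|] independent of [r], with no formula for the volume of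
    a ball. *)
Lemma lebesgue_eball_scale (r s : R) : (0 < r)%R ->
  lam (eball n s) * lam (eball n r) = lam (eball n 1) * lam (eball n (r * s)%R).
Proof.
move=> r0.
have ballE (u : R) : eball n (r * u) = (fun x : 'rV[R]_n => r^-1 *: x)%R @^-1` eball n u.
  apply/seteqP; split => x; rewrite /eball/= enormZ gtr0_norm ?invr_gt0//.
    by rewrite ltr_pdivrMl.
  by rewrite ltr_pdivrMl.
rewrite -[in lam (eball n r)](mulr1 r) !ballE.
apply: (@lebesgue_rV_additive_iso R n _ (fun x : 'rV[R]_n => r *: x)%R).
- exact: measurable_scaleV.
- exact: measurable_scaleV.
- by move=> x; rewrite scalerA mulVf ?gt_eqF// scale1r.
- by move=> x y; rewrite scalerDr.
- exact: measurable_eball.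
- exact: measurable_eball.
- by move=> x; rewrite /eball/= enormN.
Qed.

(** In the Haar identity for [B] and the unit ball one side vanishes, and the unit ball has positive
    volume. *)
Lemma lebesgue_rV_scale_null (t : R) (B : set 'rV[R]_n) : (0 < n)%N -> (0 < t)%R ->
  measurable B -> lam B = 0 -> lam ((fun x => t *: x)%R @^-1` B) = 0.
Proof.
move=> n0 t0 mB B0.
have tK : cancel (fun x : 'rV[R]_n => t^-1 *: x)%R (fun x : 'rV[R]_n => t *: x)%R.
  by move=> x; rewrite scalerA mulfV ?gt_eqF// scale1r.
have tD : {morph (fun x : 'rV[R]_n => t *: x)%R : x y / (x + y)%R}.
  by move=> x y; rewrite scalerDr.
have bN (x : 'rV[R]_n) : eball n 1 (- x)%R <-> eball n 1 x by rewrite /eball/= enormN.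
have /esym/eqP := lebesgue_rV_additive_iso n _ _ _ _ (measurable_scaleV n t)
  (measurable_scaleV n t^-1) tK tD (measurable_eball n 1) mB bN.
rewrite B0 mul0e mule_eq0 gt_eqF/=; last exact: lebesgue_eball_gt0.
by move/eqP.
Qed.

(** The unit ball is its own preimage under [rho]; its volume is positive and finite, so it cancels
    from the Haar identity. *)
Lemma lebesgue_rV_rotation (rho : 'M[R]_n) (B : set 'rV[R]_n) : (0 < n)%N ->
  rotation rho -> measurable B -> lam (mulmx^~ rho @^-1` B) = lam B.
Proof.
move=> n0 rot mB.
have [rr _] := rot.
have rK : cancel (mulmx^~ rho^T) (mulmx^~ rho : 'rV[R]_n -> 'rV[R]_n).
  by move=> x; rewrite -mulmxA (mulmx1C rr) mulmx1.
have rD : {morph (mulmx^~ rho : 'rV[R]_n -> 'rV[R]_n) : x y / (x + y)%R}.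
  by move=> x y; rewrite mulmxDl.
have bN (x : 'rV[R]_n) : eball n 1 (- x)%R <-> eball n 1 x by rewrite /eball/= enormN.
have := lebesgue_rV_additive_iso n _ _ _ _ (measurable_fun_mulmx _ _ rho)
  (measurable_fun_mulmx _ _ rho^T) rK rD (measurable_eball n 1) mB bN.
rewrite (_ : mulmx^~ rho @^-1` eball n 1 = eball n 1); last first.
  by apply/seteqP; split => x; rewrite /eball/= enorm_rotation.
have b0 := lebesgue_eball_gt0 _ n0 ltr01; have bf := lebesgue_eball_fin _ ltr01.
by move=> H; apply/eqP; rewrite eq_le -[X in X && _](lee_pmul2l bf b0)
  -[X in _ && X](lee_pmul2l bf b0) -H muleC !lexx.
Qed.


End lebesgue_eball.

(** * Surface measure: finiteness, rotation invariance, null cones *)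

Section surface_borel_theory.
Context {R : realType} (n : nat).
Hypothesis n0 : (0 < n)%N.
Local Notation lam := (lebesgue_rV_borel n : {sigma_finite_measure set 'rV[R]_n -> \bar R}).
Local Open Scope ereal_scope.

Lemma surface_borel_fin : surface_borel n [set: 'rV[R]_n] < +oo.
Proof.
rewrite /surface_borel lte_mul_pinfty//.
apply: (@le_lt_trans _ _ (lam (eball n 2))).
  apply: le_measure; rewrite ?inE.
  - exact: measurable_cone.
  - exact: measurable_eball.
  - by move=> x [/andP[_ x1] _]; rewrite /eball/= (le_lt_trans x1)// ltr1n.
by rewrite -ge0_fin_numE// lebesgue_eball_fin.
Qed.

Lemma surface_borel_rotation (rho : 'M[R]_n) (A : set 'rV[R]_n) :
  rotation rho -> measurable A ->
  surface_borel n (mulmx^~ rho @^-1` A) = surface_borel n A.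
Proof.
move=> rot mA; rewrite /surface_borel; congr (_ * _).
rewrite -[RHS](lebesgue_rV_rotation n rho)//; last exact: measurable_cone.
congr (lam _); apply/seteqP; split => x; rewrite /cone/= /normalize.
  by rewrite enorm_rotation// scalemxAl.
by rewrite enorm_rotation// scalemxAl.
Qed.

(** The infinite cone over [N] is the union of the dilates of the truncated cone by the positive
    integers, all of them null. *)
Lemma surface_null_cone (N : set 'rV[R]_n) : measurable N ->
  surface_borel n N = 0 -> lam [set x | x != 0%R /\ N (normalize x)] = 0.
Proof.
move=> mN /eqP; rewrite /surface_borel mule_eq0 eqe pnatr_eq0 gtn_eqF//= => /eqP N0.
have -> : [set x : 'rV[R]_n | x != 0%R /\ N (normalize x)] =
    \bigcup_k ((fun x : 'rV[R]_n => k.+1%:R^-1 *: x)%R @^-1` cone N).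
  apply/seteqP; split => x.
    move=> [x0 Nx]; have ex : (0 < enorm x)%R by rewrite enorm_gt0.
    (* The integer part [k] of [|x|] satisfies [|x| < k + 1], so [x / (k + 1)] is in the truncated
       cone. *)
    exists (Num.truncn (enorm x)) => //; split; last by rewrite normalizeZ// invr_gt0.
    rewrite enormZ gtr0_norm ?invr_gt0// mulr_gt0 ?invr_gt0//=.
    by rewrite ler_pdivrMl// mulr1 ltW// truncnS_gt.
  move=> [k _ [/andP[k0 _]]]; rewrite normalizeZ ?invr_gt0// => Nx; split => //.
  by move: k0; rewrite enorm_gt0 scaler_eq0 negb_or => /andP[].
have mc k : measurable ((fun x : 'rV[R]_n => k.+1%:R^-1 *: x)%R @^-1` cone N).
  by apply: measurable_preimage; [exact: measurable_scaleV|exact: measurable_cone].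
apply: measure_negligible; first exact: bigcupT_measurable.
apply: negligible_bigcup => k; apply/negligibleP => //.
apply: lebesgue_rV_scale_null => //; exact: measurable_cone.
Qed.

End surface_borel_theory.

(** * Completion of a finite measure *)

Section completion.
Local Open Scope ereal_scope.
Local Open Scope measure_scope.
Context {R : realType} {d} {T : measurableType d} (mu : {measure set T -> \bar R}).
Hypothesis mufin : mu setT < +oo.

(** A measurable hull: the intersection of countable covers of [X] whose measures exceed the outer
    measure by at most [1 / (k + 1)]. *)
Lemma outer_measure_hull (X : set T) :
  exists B, [/\ measurable B, X `<=` B & mu B = mu^* X].
Proof.
have Xfin : mu^* X \is a fin_num.
  rewrite ge0_fin_numE ?outer_measure_ge0//; apply: le_lt_trans mufin.
  by rewrite -measurable_mu_extE//; exact: le_outer_measure.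
have H k : exists B, [/\ measurable B, X `<=` B & mu B <= mu^* X + k.+1%:R^-1%:E].
  have k0 : (0 < k.+1%:R^-1 :> R)%R by rewrite invr_gt0.
  have [_ [F [mF XF] <-] FX] := lb_ereal_inf_adherent k0 Xfin.
  exists (\bigcup_i F i); split => //; first exact: bigcupT_measurable.
  apply: (le_trans _ (ltW FX)).
  by apply: measure_sigma_subadditive => //; exact: bigcupT_measurable.
have [B BP] := choice H.
exists (\bigcap_k B k).
have mB : measurable (\bigcap_k B k).
  by apply: bigcapT_measurable => k; have [] := BP k.
have XB : X `<=` \bigcap_k B k by move=> x Xx k _; have [_ + _] := BP k; exact.
split => //; apply/eqP; rewrite eq_le; apply/andP; split; last first.
  by rewrite -[leRHS]measurable_mu_extE//; exact: le_outer_measure.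
apply/lee_addgt0Pr => e e0.
have [k _ ke] : exists2 k, True & (k.+1%:R^-1 < e)%R.
  exists (Num.truncn e^-1) => //.
  by rewrite invf_plt ?posrE// truncnS_gt.
have [mBk _ Bk] := BP k.
apply: (@le_trans _ _ (mu (B k))).
  by apply: le_measure; rewrite ?inE//; exact: bigcap_inf.
by apply: (le_trans Bk); rewrite leeD2l// lee_fin ltW.
Qed.

(** [B] is a hull of [A] and [N] a hull of [B] minus [A]. The Caratheodory equality tested on [B]
    reads [mu B = mu B + mu N], whence [mu N = 0] because [mu B] is finite. *)
Lemma caratheodory_borel (A : set T) : (mu^*).-cara.-measurable A ->
  exists B N, [/\ measurable B, measurable N, mu N = 0 &
    forall x, ~ N x -> (A x <-> B x)].
Proof.
move=> mA; have [B [mB AB muB]] := outer_measure_hull A.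
have [N [mN BN muN]] := outer_measure_hull (B `&` ~` A).
exists B, N; split => //; last first.
  move=> x Nx; split => [/AB//|Bx]; apply: contrapT => Ax; exact/Nx/BN.
have Bfin : mu B \is a fin_num.
  by rewrite ge0_fin_numE//; apply: le_lt_trans mufin; apply: le_measure; rewrite ?inE.
have E : mu^* B = mu^* (B `&` A) + mu^* (B `&` ~` A) := mA B.
move: E; rewrite (setIidr AB) -muN -muB measurable_mu_extE// addeC.
by move=> /(congr1 (fun z => z - mu B)); rewrite addeK// subee.
Qed.

(** Each set where [f > q], [q] rational, is Borel up to a null Borel set. Off the countable union
    of these null sets, [f > x] holds exactly when some rational [q > x] has [f > q]. *)
Lemma completed_measurable_fun (D : set T) (f : T -> R) : measurable D ->
  measurable_fun (D : set (caratheodory_type mu^*)) f ->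
  exists N, [/\ measurable N, mu N = 0 & measurable_fun (D `\` N) f].
Proof.
move=> mD mf.
have mcD : (mu^*).-cara.-measurable D.
  by apply: sub_caratheodory; exact: sub_sigma_algebra.
have H (q : rat) : exists BN : set T * set T,
    [/\ measurable BN.1, measurable BN.2, mu BN.2 = 0 &
    forall x, ~ BN.2 x -> (D x /\ (ratr q < f x)%R) <-> BN.1 x].
  have := caratheodory_borel (D `&` f @^-1` `]ratr q, +oo[) (mf mcD _ (measurable_itv _)).
  move=> [B [N [mB mN N0 AB]]]; exists (B, N); split => // x /= Nx.
  by rewrite -(AB _ Nx)/= in_itv/= andbT.
have [BN BNP] := choice H.
(* The null sets are reindexed by the naturals; a number that encodes no rational contributes the
   empty set. *)
pose F k := if unpickle k is Some q then (BN q).2 else set0.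
have mF k : measurable (F k).
  by rewrite /F; case: unpickle => // q; have [] := BNP q.
have NF q : (BN q).2 `<=` \bigcup_k F k.
  by move=> y Nq; exists (pickle q); [exact: I|rewrite /F pickleK].
exists (\bigcup_k F k); split.
- exact: bigcupT_measurable.
- apply: measure_negligible; first exact: bigcupT_measurable.
  apply: negligible_bigcup => k; apply/negligibleP => //.
  by rewrite /F; case: unpickle => [q|]; rewrite ?measure0//; have [] := BNP q.
- move=> mDN; apply: (measurability _ (RGenOInfty.measurableE R)) => //.
    move=> _ [_ [x ->] <-].
  rewrite (_ : _ `&` _ = \bigcup_(q : rat) if (x < ratr q)%R then
       (D `\` \bigcup_k F k) `&` (BN q).1 else set0); last first.
    apply/seteqP; split => y.
      move=> [[Dy Ny]] /=; rewrite in_itv/= andbT => xfy.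
      have [q] := rat_in_itvoo xfy; rewrite in_itv/= => /andP[xq qf].
      exists q => //; rewrite xq; split => //.
      have [_ _ _ <- //] := BNP q.
      by move=> Nq; apply: Ny; exact: NF Nq.
    move=> [q _]; case: ifP => // xq [[Dy Ny] By]; split => //=.
    have [_ _ _ /(_ y)] := BNP q; case.
      by move=> Nq; apply: Ny; exact: NF Nq.
    by move=> _ /(_ By) [_ qf]; rewrite in_itv/= andbT (lt_trans xq).
  apply: bigcupT_measurable_rat => q; case: ifP => // _.
  by apply: measurableI => //; have [] := BNP q.
Qed.

(** By completeness [f] inherits measurability from [g] for the completed sigma-algebra and has the
    same integral. The identity map then pushes the completed measure forward to [mu] on Borel
    sets. *)
Lemma ge0_integral_completion (D N : set T) (f g : T -> \bar R) :
  measurable D -> measurable N -> mu N = 0 -> measurable_fun D g ->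
  (forall x, D x -> 0 <= f x) -> (forall x, D x -> 0 <= g x) ->
  (forall x, D x -> ~ N x -> f x = g x) ->
  \int[@completed_measure_extension _ _ _ mu]_(x in D) f x = \int[mu]_(x in D) g x.
Proof.
move=> mD mN N0 mg f0 g0 fg.
pose cT := caratheodory_type mu^*.
have sub (A : set T) : measurable A -> measurable (A : set cT).
  by move=> mA; apply: sub_caratheodory; exact: sub_sigma_algebra.
pose cmu := @completed_measure_extension _ _ _ mu.
have mcg : measurable_fun (D : set cT) g.
  by move=> _ Y mY; apply: sub; exact: mg.
have ae : ae_eq cmu (D : set cT) g f.
  exists N; split; [exact: sub| |].
    exact: etrans (measurable_mu_extE _ mN) N0.
  by move=> x /=; apply: contra_notP => Nx Dx; rewrite fg.
have mcf : measurable_fun (D : set cT) f.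
  apply: (@ae_measurable_fun _ _ R cmu _ D g f) => //.
  exact: (@measure_is_complete_caratheodory R T (mu_ext mu)).
rewrite -(ge0_ae_eq_integral _ mcg mcf)//; last exact: sub.
have mid : measurable_fun [set: cT] (id : cT -> T).
  by move=> _ Y mY; rewrite setTI; exact: sub.
transitivity (\int[pushforward cmu (id : cT -> T)]_(x in D) g x).
  rewrite ge0_integral_pushforward//.
  by move=> x /set_mem; exact: g0.
apply: eq_measure_integral => A mA _.
exact: measurable_mu_extE.
Qed.

End completion.

(** * Tonelli on rectangles, and monotonicity of the integral *)

Section fubini_tonelli_rectangle.
Local Open Scope ereal_scope.
Context {d1 d2} {T1 : measurableType d1} {T2 : measurableType d2} {R : realType}.
Variables (m1 : {sigma_finite_measure set T1 -> \bar R})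
  (m2 : {sigma_finite_measure set T2 -> \bar R}).
Variables (A : set T1) (B : set T2) (f : T1 * T2 -> \bar R).
Hypotheses (mA : measurable A) (mB : measurable B).
Hypotheses (mf : measurable_fun setT f) (f0 : forall p, 0 <= f p).

Let fAB := f \_ (A `*` B).

Let mfAB : measurable_fun setT fAB.
Proof.
apply/(measurable_restrictT _ _).1; first exact: measurableX.
exact: measurable_funTS.
Qed.

Let fAB0 p : 0 <= fAB p. Proof. exact: erestrict_ge0. Qed.

Let fAB_A x : A x -> (fun y => fAB (x, y)) = (fun y => f (x, y)) \_ B.
Proof.
by move=> Ax; apply/funext => y; rewrite /fAB !patchE in_setX (mem_set Ax).
Qed.

Let fAB_B y : B y -> (fun x => fAB (x, y)) = (fun x => f (x, y)) \_ A.
Proof.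
move=> By; apply/funext => x; rewrite /fAB !patchE in_setX (mem_set By).
by rewrite andbT.
Qed.

Lemma fubini_tonelli_rectangle :
  \int[m1]_(x in A) \int[m2]_(y in B) f (x, y) =
  \int[m2]_(y in B) \int[m1]_(x in A) f (x, y).
Proof.
transitivity (\int[m1]_x \int[m2]_y fAB (x, y)).
  rewrite integral_mkcond; apply: eq_integral => x _; rewrite patchE.
  case: ifPn => [/set_mem Ax|Ax]; first by rewrite fAB_A// -integral_mkcond.
  apply/esym/integral0_eq => y _; rewrite /fAB patchE ifF// in_setX.
  by rewrite (negbTE Ax).
rewrite (fubini_tonelli fAB)// [RHS]integral_mkcond; apply: eq_integral => y _.
rewrite patchE; case: ifPn => [/set_mem By|By]; first by rewrite fAB_B// -integral_mkcond.
apply/integral0_eq => x _; rewrite /fAB patchE ifF// in_setX.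
by rewrite (negbTE By) andbF.
Qed.

Lemma measurable_fun_integral_r : measurable_fun A (fun x => \int[m2]_(y in B) f (x, y)).
Proof.
apply: (eq_measurable_fun (fun x => \int[m2]_y fAB (x, y))).
  by move=> x /set_mem Ax; rewrite fAB_A// -integral_mkcond.
apply: measurable_funTS; exact: (measurable_fun_fubini_tonelli_F _ mfAB).
Qed.

Lemma measurable_fun_integral_l : measurable_fun B (fun y => \int[m1]_(x in A) f (x, y)).
Proof.
apply: (eq_measurable_fun (fun y => \int[m1]_x fAB (x, y))).
  by move=> y /set_mem By; rewrite fAB_B// -integral_mkcond.
apply: measurable_funTS; exact: (measurable_fun_fubini_tonelli_G _ mfAB).
Qed.

End fubini_tonelli_rectangle.

(** The integral of a nonnegative function is a supremum over the simple functions below it, hence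
    monotone. This form applies to [l1_modulus] as a function of [delta], a supremum over rotations
    whose measurability is not established. *)
Lemma ge0_le_integral_nonmeas d (T : measurableType d) (R : realType)
    (mu : {measure set T -> \bar R}) (D : set T) (f g : T -> \bar R) :
  (forall x, D x -> 0 <= f x)%E -> (forall x, D x -> f x <= g x)%E ->
  (\int[mu]_(x in D) f x <= \int[mu]_(x in D) g x)%E.
Proof.
move=> f0 fg.
rewrite !ge0_integralE//; last by move=> x Dx; apply: le_trans (fg _ Dx); exact: f0.
apply: le_ereal_sup => _ [h hf <-]; exists h => // x.
by apply: le_trans (hf x) _; rewrite !patchE; case: ifPn => // /set_mem /fg.
Qed.

(** * Averaging over small balls, for a rotation-invariant measure and a Borel function *)

Section averaging.
Local Open Scope ereal_scope.
Context {R : realType} (n : nat).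
Hypothesis n0 : (0 < n)%N.
Local Notation lam := (lebesgue_rV_borel n : {sigma_finite_measure set 'rV[R]_n -> \bar R}).
Variable s : {finite_measure set 'rV[R]_n -> \bar R}.
Hypothesis s_rot : forall (rho : 'M[R]_n) A, rotation rho -> measurable A ->
  s (mulmx^~ rho @^-1` A) = s A.
Variable g : 'rV[R]_n -> R.
Hypothesis mg : measurable_fun setT g.
Local Notation S := (unit_sphere n : set 'rV[R]_n).

Lemma measurable_fun_absB d (T : measurableType d) (a b : T -> 'rV[R]_n) :
  measurable_fun setT a -> measurable_fun setT b ->
  measurable_fun setT (fun t => `|g (a t) - g (b t)|%:E).
Proof.
move=> ma mb; apply/measurable_EFinP.
apply: (@measurableT_comp _ _ _ _ _ _ (@Num.norm R R)) => //.
by apply: measurable_funB; exact: measurableT_comp mg _.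
Qed.

Lemma ge0_integral_shift (a : 'rV[R]_n) (D : set 'rV[R]_n) (h : 'rV[R]_n -> \bar R) :
  measurable D -> measurable_fun setT h -> (forall x, 0 <= h x) ->
  \int[lam]_(x in (fun x => (x + a)%R) @^-1` D) h (x + a)%R = \int[lam]_(x in D) h x.
Proof.
move=> mD mh h0.
have mphi := measurable_addV n a.
transitivity (\int[pushforward lam (fun x : 'rV[R]_n => (x + a)%R)]_(x in D) h x).
  by rewrite ge0_integral_pushforward//; exact: measurable_funTS.
by apply: eq_measure_integral => A mA _; exact: lebesgue_rV_shift.
Qed.

Lemma ge0_integral_rotation (rho : 'M[R]_n) (h : 'rV[R]_n -> \bar R) :
  rotation rho -> measurable_fun setT h -> (forall x, 0 <= h x) ->
  \int[s]_(x in S) h (x *m rho)%R = \int[s]_(x in S) h x.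
Proof.
move=> rot mh h0.
have mphi := measurable_fun_mulmx n n rho.
transitivity (\int[pushforward s (mulmx^~ rho : 'rV[R]_n -> 'rV[R]_n)]_(x in S) h x).
  rewrite ge0_integral_pushforward//; last first.
  - exact: measurable_funTS.
  - exact: measurable_unit_sphere.
  rewrite (_ : mulmx^~ rho @^-1` S = S)//.
  by apply/seteqP; split => x; rewrite /unit_sphere/= enorm_rotation.
by apply: eq_measure_integral => A mA _; exact: s_rot.
Qed.

(** The integral of hypothesis (3), with [g] for [Omega] and one vector [w] for [delta *: xi]. *)
Definition osc (w : 'rV[R]_n) := \int[s]_(x in S) `|g x - g (x + w)|%:E.

Lemma measurable_osc D : measurable D -> measurable_fun D osc.
Proof.
move=> mD.
have mh : measurable_fun setT (fun p : 'rV[R]_n * 'rV[R]_n => `|g p.1 - g (p.1 + p.2)|%:E).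
  apply: measurable_fun_absB; first exact: measurable_fst.
  by apply: measurable_fun_addV; [exact: measurable_fst|exact: measurable_snd].
have := measurable_fun_integral_l s _ _ _ (measurable_unit_sphere n) mD mh.
by apply => p; rewrite lee_fin.
Qed.

Lemma integral_osc_eball (M d r : R) : (0 <= M)%R -> (0 < r <= d)%R ->
  {ae lam, forall w, (enorm w < d)%R -> osc w <= (M * enorm w)%:E} ->
  \int[lam]_(w in eball n r) osc w <= (M * r)%:E * lam (eball n r).
Proof.
move=> M0 /andP[r0 rd] H; rewrite -integral_cst; last exact: measurable_eball.
apply: ae_ge0_le_integral.
- exact: measurable_eball.
- by move=> w _; apply: integral_ge0 => x _; rewrite lee_fin.
- by apply: measurable_osc; exact: measurable_eball.
- by move=> w _; rewrite lee_fin mulr_ge0// ltW.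
- exact: measurable_cst.
apply: filterS H => w H; rewrite /eball/= => wr.
apply: le_trans (H (lt_le_trans wr rd)) _.
by rewrite lee_fin ler_wpM2l// ltW.
Qed.

(* Average over the points z = x rho + w, |w| < r, of
   |g (x rho) - g x| <= |g (x rho) - g z| + |g z - g x|; since |z - x| < 2 r, both terms are
   differences under a translation independent of x. *)
Lemma averaging_pointwise (rho : 'M[R]_n) (r : R) (x : 'rV[R]_n) : (0 < r)%R ->
  (enorm (x *m rho - x) <= r)%R ->
  lam (eball n r) * `|g (x *m rho) - g x|%:E <=
  \int[lam]_(w in eball n r) `|g (x *m rho) - g (x *m rho + w)|%:E +
  \int[lam]_(w in eball n (2 * r)) `|g x - g (x + w)|%:E.
Proof.
move=> r0 xr; have mB := measurable_eball n r.
have mD (a : 'rV[R]_n) : measurable_fun setT (fun w => (a + w)%R).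
  by apply: measurable_fun_addV => //; exact: measurable_cst.
rewrite muleC -integral_cst//.
pose h w := `|g x - g (x + w)|%:E.
have mh : measurable_fun setT h by apply: measurable_fun_absB.
apply: (@le_trans _ _ (\int[lam]_(w in eball n r)
    (`|g (x *m rho) - g (x *m rho + w)|%:E + h (w + (x *m rho - x))%R))).
  apply: ge0_le_integral_nonmeas => w _; first by rewrite lee_fin.
  rewrite /h -EFinD lee_fin addrCA (addrC w) subrKC //.
  rewrite (_ : (_ - g x)%R = (g (x *m rho) - g (x *m rho + w)) - (g x - g (x *m rho + w)))%R.
    exact: ler_normB.
  by rewrite opprB addrA subrK.
have mh1 : measurable_fun (eball n r) (fun w => `|g (x *m rho) - g (x *m rho + w)|%:E).
  by apply: measurable_funTS; apply: measurable_fun_absB.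
have mh2 : measurable_fun (eball n r) (fun w => h (w + (x *m rho - x))%R).
  by apply: measurable_funTS; apply: measurableT_comp => //; exact: measurable_addV.
rewrite ge0_integralD//; last by move=> w _; rewrite lee_fin.
apply: leeD => //.
(* Translation by [x rho - x], of length at most [r], sends the ball of radius [r] into that of
   radius [2 r]. *)
rewrite -(@ge0_integral_shift (x *m rho - x)%R (eball n (2 * r)))//;
  last exact: measurable_eball.
apply: ge0_subset_integral => //.
- by apply: measurable_preimage; [exact: measurable_addV|exact: measurable_eball].
- by apply: measurable_funTS; apply: measurableT_comp => //; exact: measurable_addV.
- by move=> w _; rewrite lee_fin.
- move=> w; rewrite /eball/= => wr; rewrite addrC; exact: enormD_lt2.
Qed.

(** The pointwise bound is integrated over the sphere and the integrals are exchanged. For fixed [w]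
    the first integrand depends on [x] through [x rho] only, so rotation invariance turns its
    integral into [osc w]. *)
Lemma averaging (rho : 'M[R]_n) (r : R) : (0 < r)%R -> rotation rho ->
  (forall x, S x -> enorm (x *m rho - x) <= r)%R ->
  lam (eball n r) * \int[s]_(x in S) `|g (x *m rho) - g x|%:E <=
  \int[lam]_(w in eball n r) osc w + \int[lam]_(w in eball n (2 * r)) osc w.
Proof.
move=> r0 rot xr; have mB (t : R) := measurable_eball n t.
have mS : measurable S := measurable_unit_sphere n.
have mrho := measurable_fun_mulmx n n rho.
have mid : measurable_fun setT (fun x : 'rV[R]_n => x) by [].
have m1 : measurable_fun setT (fun p : 'rV[R]_n * 'rV[R]_n =>
    `|g (p.1 *m rho) - g (p.1 *m rho + p.2)|%:E).
  have mp1 : measurable_fun setT (fun p : 'rV[R]_n * 'rV[R]_n => p.1 *m rho).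
    exact: measurableT_comp mrho measurable_fst.
  apply: measurable_fun_absB => //.
  by apply: measurable_fun_addV => //; exact: measurable_snd.
have m2 : measurable_fun setT (fun p : 'rV[R]_n * 'rV[R]_n => `|g p.1 - g (p.1 + p.2)|%:E).
  apply: measurable_fun_absB; first exact: measurable_fst.
  by apply: measurable_fun_addV; [exact: measurable_fst|exact: measurable_snd].
rewrite -ge0_integralZl//; last first.
  by apply: measurable_funTS; exact: measurable_fun_absB.
apply: (@le_trans _ _ (\int[s]_(x in S)
    (\int[lam]_(w in eball n r) `|g (x *m rho) - g (x *m rho + w)|%:E +
     \int[lam]_(w in eball n (2 * r)) `|g x - g (x + w)|%:E))).
  apply: ge0_le_integral_nonmeas => x Sx; first by rewrite mule_ge0.
  by apply: averaging_pointwise => //; exact: xr.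
rewrite ge0_integralD//; last 4 first.
- by move=> x _; apply: integral_ge0.
- exact: (measurable_fun_integral_r lam _ _ _ mS (mB r) m1).
- by move=> x _; apply: integral_ge0.
- exact: (measurable_fun_integral_r lam _ _ _ mS (mB (2 * r)%R) m2).
apply: leeD.
  rewrite (fubini_tonelli_rectangle s lam _ _ _ mS (mB r) m1); last first.
    by move=> p; rewrite lee_fin.
  rewrite (_ : (fun w => _) = osc); first exact: lexx.
  apply/funext => w.
  apply: (ge0_integral_rotation rho (fun x => `|g x - g (x + w)|%:E)) => //.
  by apply: measurable_fun_absB => //; exact: measurable_addV.
rewrite (fubini_tonelli_rectangle s lam _ _ _ mS (mB (2 * r)%R) m2); last first.
  by move=> p; rewrite lee_fin.
exact: lexx.
Qed.

(** Averaging bounds [|B(0, r)|] times the integral by [M r |B(0, r)| + 2 M r |B(0, 2 r)|]; dividing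
    by [|B(0, r)|] leaves the ratio [|B(0, 2)| / |B(0, 1)|]. The condition [2 r <= d] lets the
    hypothesis reach the larger ball. *)
Lemma rotation_modulus_le (M d r : R) (rho : 'M[R]_n) : (0 <= M)%R ->
  {ae lam, forall w, (enorm w < d)%R -> osc w <= (M * enorm w)%:E} ->
  (0 < r)%R -> (2 * r <= d)%R -> rotation rho ->
  (forall x, S x -> enorm (x *m rho - x) <= r)%R ->
  \int[s]_(x in S) `|g (x *m rho) - g x|%:E <=
  ((M + 2 * M * (fine (lam (eball n 2)) / fine (lam (eball n 1)))) * r)%:E.
Proof.
move=> M0 Hae r0 rd rot xr.
have fE t : (0 < t)%R -> exists2 a : R, lam (eball n t) = a%:E & (0 < a)%R.
  move=> t0; exists (fine (lam (eball n t))); first by rewrite fineK// lebesgue_eball_fin.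
  by rewrite -lte_fin fineK ?lebesgue_eball_fin// lebesgue_eball_gt0.
have H := averaging rho r r0 rot xr.
have H1 : \int[lam]_(w in eball n r) osc w <= (M * r)%:E * lam (eball n r).
  by apply: integral_osc_eball Hae => //; lra.
have r20 : (0 < 2 * r)%R by lra.
have H2 : \int[lam]_(w in eball n (2 * r)) osc w <= (M * (2 * r))%:E * lam (eball n (2 * r)).
  by apply: integral_osc_eball Hae => //; lra.
have := le_trans H (leeD H1 H2).
have := lebesgue_eball_scale n r 2%R r0; rewrite (mulrC r 2%R).
have [a -> a0] := fE _ r0; have [a2 -> _] := fE _ r20.
have [b1 -> b10] := fE _ ltr01; have [b2 -> _] := fE 2%R ltac:(lra).
rewrite /= -!EFinM -!EFinD => -[E].
rewrite -lee_pdivlMl// -EFinM => /le_trans; apply; rewrite lee_fin.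
have -> : a2 = (b2 * a / b1)%R by rewrite E mulrAC mulfV ?gt_eqF ?mul1r.
rewrite le_eqVlt; apply/orP; left; apply/eqP; field.
by rewrite !gt_eqF.
Qed.

End averaging.

(** * A Borel representative of [Omega] and its integrals *)

Section surface_finite.
Context {R : realType} (n : nat).

Let surface_borel_fin_num : fin_num_fun (@surface_borel R n).
Proof.
move=> A mA; rewrite ge0_fin_numE//; apply: le_lt_trans (surface_borel_fin n).
by apply: le_measure; rewrite ?inE.
Qed.

HB.instance Definition _ := Measure_isFinite.Build _ _ _ (@surface_borel R n)
  surface_borel_fin_num.

End surface_finite.

Section borel_representative.
Context {R : realType} (n : nat).
Hypothesis n0 : (0 < n)%N.
Local Notation lam := (lebesgue_rV_borel n : {sigma_finite_measure set 'rV[R]_n -> \bar R}).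
Local Notation s := (surface_borel n : {finite_measure set 'rV[R]_n -> \bar R}).
Local Notation S := (unit_sphere n : set 'rV[R]_n).
Local Open Scope ereal_scope.

Lemma borel_representative (Omega : 'rV[R]_n -> R) :
  (surface_measure n).-integrable S (EFin \o Omega) ->
  (forall (t : R) x, (0 < t)%R -> x != 0%R -> Omega (t *: x)%R = Omega x) ->
  exists (g : 'rV[R]_n -> R) (N : set 'rV[R]_n),
    [/\ measurable_fun setT g, measurable N, s N = 0 &
    forall x, x != 0%R -> ~ N (normalize x) -> Omega x = g x].
Proof.
move=> iO hO.
have mS := @measurable_unit_sphere R n.
have mO : measurable_fun (S : set (caratheodory_type (mu_ext s))) Omega.
  by apply/measurable_EFinP; exact: measurable_int iO.
have [N [mN N0 mON]] := completed_measurable_fun s (surface_borel_fin n) S Omega mS mO.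
(* [Omega] on the sphere, set to 0 on [N], is extended along rays; by homogeneity this agrees with
   [Omega] off the cone over [N]. *)
exists ((Omega \_ (S `\` N)) \o @normalize R n), N; split => //.
  apply: measurableT_comp; last exact: measurable_normalize.
  by apply/(measurable_restrictT _ _).1 => //; exact: measurableD.
move=> x x0 Nx; rewrite /= patchE mem_set/=; last first.
  by split => //; exact: enorm_normalize.
by rewrite /normalize hO// invr_gt0 enorm_gt0.
Qed.

(** Tonelli for the indicator of [x + w] in [Z]: for each [x] the set of such [w] is a translate of
    [Z], hence null, so the double integral vanishes. *)
Lemma ae_sphere_translate_null (Z : set 'rV[R]_n) : measurable Z -> lam Z = 0 ->
  {ae lam, forall w, s (S `&` (fun x => x + w)%R @^-1` Z) = 0}.
Proof.
move=> mZ Z0; have mS := @measurable_unit_sphere R n.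
pose f (p : 'rV[R]_n * 'rV[R]_n) : \bar R := (\1_Z (p.1 + p.2)%R)%:E.
have mf : measurable_fun setT f.
  apply/measurable_EFinP; apply: (measurableT_comp (measurable_indic _)) => //.
  by apply: measurable_fun_addV; [exact: measurable_fst|exact: measurable_snd].
have f0 p : 0 <= f p by rewrite lee_fin.
have sE w : \int[s]_(x in S) f (x, w) = s (S `&` (fun x => x + w)%R @^-1` Z).
  rewrite setIC -integral_indic//.
  by apply: measurable_preimage => //; exact: measurable_addV.
have int0 : \int[lam]_(w in setT) \int[s]_(x in S) f (x, w) = 0.
  rewrite -(fubini_tonelli_rectangle s lam _ _ _ mS measurableT mf f0).
  apply: integral0_eq => x Sx.
  transitivity (lam ((fun w => w + x)%R @^-1` Z)); last by rewrite lebesgue_rV_shift.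
  rewrite -[X in lam X]setIT -integral_indic//; last first.
    by apply: measurable_preimage => //; exact: measurable_addV.
  by apply: eq_integral => w _; rewrite /f/= !indicE /preimage addrC.
have mi := measurable_fun_integral_l s _ _ _ mS measurableT mf f0.
have /(ae_eq_integral_abs lam measurableT mi) :
    \int[lam]_(w in setT) `| \int[s]_(x in S) f (x, w) | = 0.
  rewrite -[RHS]int0; apply: eq_integral => w _; rewrite gee0_abs//.
  exact: integral_ge0.
apply: filterS => w /(_ I); rewrite sE//.
Qed.

End borel_representative.

Section representative_integrals.
Context {R : realType} (n : nat).
Hypothesis n0 : (0 < n)%N.
Local Notation lam := (lebesgue_rV_borel n : {sigma_finite_measure set 'rV[R]_n -> \bar R}).
Local Notation s := (surface_borel n : {finite_measure set 'rV[R]_n -> \bar R}).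
Local Notation S := (unit_sphere n : set 'rV[R]_n).
Local Open Scope ereal_scope.
Variables (Omega g : 'rV[R]_n -> R) (N : set 'rV[R]_n).
Hypotheses (mg : measurable_fun setT g) (mN : measurable N) (N0 : s N = 0).
Hypothesis gO : forall x, x != 0%R -> ~ N (normalize x) -> Omega x = g x.

Let mS : measurable S := measurable_unit_sphere n.

Let gO_sphere x : S x -> ~ N x -> Omega x = g x.
Proof.
by move=> Sx Nx; apply: gO; [exact: unit_sphere_neq0|rewrite normalize_sphere].
Qed.

Let measurable_normalize_preimage :
  measurable [set x : 'rV[R]_n | x != 0%R /\ N (normalize x)].
Proof.
have -> : [set x : 'rV[R]_n | x != 0%R /\ N (normalize x)] =
    ~` (@enorm R n @^-1` [set 0%R]) `&` @normalize R n @^-1` N.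
  apply/seteqP; split => x /=; rewrite -enorm_gt0 lt0r enorm_ge0 andbT.
    by move=> [/eqP].
  by move=> [/eqP].
apply: measurableI; last by apply: measurable_preimage => //; exact: measurable_normalize.
by apply: measurableC; apply: measurable_preimage => //; exact: measurable_enorm.
Qed.

Lemma integral_norm_representative :
  \int[surface_measure n]_(x in S) `|Omega x|%:E = \int[s]_(x in S) `|g x|%:E.
Proof.
apply: (@ge0_integral_completion R _ _ (surface_borel n) S N) => //.
- apply: measurable_funTS; apply/measurable_EFinP; exact: measurableT_comp.
- by move=> x Sx Nx; rewrite gO_sphere.
Qed.

Lemma integral_rotation_representative (rho : 'M[R]_n) : rotation rho ->
  \int[surface_measure n]_(x in S) `|Omega (x *m rho) - Omega x|%:E =
  \int[s]_(x in S) `|g (x *m rho) - g x|%:E.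
Proof.
move=> rot; have mrho := measurable_fun_mulmx n n rho.
have mrN : measurable ((mulmx^~ rho : 'rV[R]_n -> 'rV[R]_n) @^-1` N).
  exact: measurable_preimage.
(* The exceptional set accounts for both [x] and [x rho]; its second half is null by rotation
   invariance. *)
apply: (@ge0_integral_completion R _ _ (surface_borel n) S (N `|` mulmx^~ rho @^-1` N)) => //.
- exact: measurableU.
- apply: measure_negligible; first exact: measurableU.
  apply: negligibleU; apply/negligibleP => //.
  exact: etrans (surface_borel_rotation n n0 rho N rot mN) N0.
- by apply: measurable_funTS; exact: measurable_fun_absB.
- move=> x Sx /not_orP[Nx Nrx]; rewrite !gO_sphere//.
  by rewrite /unit_sphere/= enorm_rotation.
Qed.

Lemma integral_translate_representative (w : 'rV[R]_n) : (enorm w < 1)%R ->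
  s (S `&` (fun x => x + w)%R @^-1` [set x | x != 0%R /\ N (normalize x)]) = 0 ->
  \int[surface_measure n]_(x in S) `|Omega x - Omega (x + w)|%:E = osc n s g w.
Proof.
move=> w1; set Z := S `&` _ => Z0.
have mZ : measurable Z.
  apply: measurableI => //; apply: measurable_preimage; first exact: measurable_addV.
  exact: measurable_normalize_preimage.
apply: (@ge0_integral_completion R _ _ (surface_borel n) S (N `|` Z)) => //.
- exact: measurableU.
- apply: measure_negligible; first exact: measurableU.
  by apply: negligibleU; apply/negligibleP.
- by apply: measurable_funTS; apply: measurable_fun_absB => //; exact: measurable_addV.
- move=> x Sx /not_orP[Nx NZ]; rewrite gO_sphere//.
  (* [x + w = 0] would force [|w| = |x| = 1]. *)
  have xw0 : (x + w != 0)%R.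
    apply: contraTneq w1 => /eqP; rewrite addrC addr_eq0 => /eqP ->.
    by rewrite enormN Sx ltxx.
  by rewrite gO// => Nxw; apply: NZ.
Qed.

(** For almost every [w], translation by [w] sends only a null part of the sphere into the cone over
    [N]; the bound for [Omega] then passes to [g]. The case [w = 0], which the hypothesis leaves
    out, is trivial. *)
Lemma ae_osc_le (M : R) : (0 <= M)%R ->
  (forall w, (0 < enorm w < n%:R^-1)%R ->
    \int[surface_measure n]_(x in S) `|Omega x - Omega (x + w)|%:E <= (M * enorm w)%:E) ->
  {ae lam, forall w, (enorm w < n%:R^-1)%R -> osc n s g w <= (M * enorm w)%:E}.
Proof.
move=> M0 H.
have mZ := measurable_normalize_preimage.
apply: filterS (ae_sphere_translate_null n _ mZ (surface_null_cone n n0 _ mN N0)) => w wZ wn.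
have [w0|w0] := eqVneq w 0%R.
  rewrite /osc integral0_eq ?lee_fin ?mulr_ge0 ?enorm_ge0// => x _.
  by rewrite w0 addr0 subrr normr0.
rewrite -integral_translate_representative//; last first.
  by rewrite (lt_le_trans wn)// invf_le1 ?ltr0n// ler1n.
by apply: H; rewrite enorm_gt0 w0.
Qed.

End representative_integrals.

(** * General bounds on the modulus [omega_1] *)

Section modulus.
Context {R : realType} (n : nat).
Local Notation S := (unit_sphere n : set 'rV[R]_n).
Local Open Scope ereal_scope.
Implicit Type Omega : 'rV[R]_n -> R.

(** The identity is an admissible rotation when [delta >= 0], so the supremum is not over the empty
    set, where it would be [-oo]. *)
Lemma l1_modulus_ge0 Omega (delta : R) : (0 <= delta)%R -> 0 <= l1_modulus Omega delta.
Proof.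
move=> d0; apply: (@le_trans _ _ (\int[surface_measure n]_(x in S)
    `|Omega (x *m 1%:M) - Omega x|%:E)).
  by apply: integral_ge0 => x _; rewrite lee_fin.
apply: ereal_sup_ubound; exists 1%:M => //=; split.
  by split; [rewrite trmx1 mulmx1|rewrite det1].
apply: ge_ereal_sup => _ [x _ <-].
by rewrite mulmx1 subrr -(scale0r 0) enormZ normr0 mul0r lee_fin.
Qed.

Lemma le_l1_modulus Omega (delta : R) (b : \bar R) :
  (forall rho : 'M[R]_n, rotation rho ->
    (forall x, S x -> enorm (x *m rho - x) <= delta)%R ->
    \int[surface_measure n]_(x in S) `|Omega (x *m rho) - Omega x|%:E <= b) ->
  l1_modulus Omega delta <= b.
Proof.
move=> H; apply: ge_ereal_sup => _ [rho [rot norm_rho] <-].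
apply: H => // x Sx; rewrite -lee_fin; apply: le_trans norm_rho.
by apply: ereal_sup_ubound; exists x.
Qed.

(** By rotation invariance [|g (x rho)|] and [|g x|] have the same integral. *)
Lemma rotation_difference_le (s : {finite_measure set 'rV[R]_n -> \bar R}) (g : 'rV[R]_n -> R)
    (rho : 'M[R]_n) :
  (forall (rho : 'M[R]_n) A, rotation rho -> measurable A ->
    s (mulmx^~ rho @^-1` A) = s A) ->
  measurable_fun setT g -> rotation rho ->
  \int[s]_(x in S) `|g (x *m rho) - g x|%:E <= 2%:E * \int[s]_(x in S) `|g x|%:E.
Proof.
move=> s_rot mg rot; have mS : measurable S := measurable_unit_sphere n.
have mabs : measurable_fun setT (fun x => `|g x|%:E).
  by apply/measurable_EFinP; exact: measurableT_comp.
have mabs_rho : measurable_fun S (fun x => `|g (x *m rho)|%:E).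
  apply: measurable_funTS; apply: (measurableT_comp mabs).
  exact: measurable_fun_mulmx.
apply: (@le_trans _ _ (\int[s]_(x in S) (`|g (x *m rho)|%:E + `|g x|%:E))).
  apply: ge0_le_integral_nonmeas => x _; first by rewrite lee_fin.
  by rewrite -EFinD lee_fin ler_normB.
rewrite ge0_integralD//; last exact: measurable_funTS.
rewrite (ge0_integral_rotation n s s_rot rho (fun x => `|g x|%:E))//.
by rewrite mule_natl mule2n.
Qed.

End modulus.

(** * Linear bound on [omega_1] near 0 and convergence of the Dini integral *)

Theorem proposition2p1 (R : realType) (n : nat) (hn : (0 < n)%N)
  (Omega : 'rV[R]_n -> R)
  (measOmega : lebesgue_measurable_fun [set~ 0] Omega)
  (intOmega : (surface_measure n).-integrable (unit_sphere n) (EFin \o Omega))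
  (homOmega : forall (lambda : R) (x : 'rV[R]_n),
     0 < lambda -> x != 0 -> Omega (lambda *: x) = Omega x)
  (meanOmega :
     (\int[surface_measure n]_(theta in unit_sphere n) (Omega theta)%:E = 0)%E)
  (modOmega : exists2 C : R, 0 < C & forall delta : R,
     0 < delta < n%:R^-1 ->
     (ereal_sup [set \int[surface_measure n]_(theta in unit_sphere n)
                       `|Omega theta - Omega (theta + delta *: xi)|%R%:E
                | xi in unit_sphere n]
      <= (C * n%:R * delta)%:E *
         \int[surface_measure n]_(theta in unit_sphere n)
            `|Omega theta|%R%:E)%E) :
  l1_dini Omega.

Proof.
have [C C0 H] := modOmega.
set L := (\int[surface_measure n]_(theta in unit_sphere n) `|Omega theta|%:E)%E in H.
have L0 : (0 <= L)%E by apply: integral_ge0 => x _; rewrite lee_fin.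
have Lfin : (L \is a fin_num)%E.
  by rewrite ge0_fin_numE//; have /integrableP[_] := intOmega.
pose l := fine L; have Ll : L = l%:E by rewrite fineK.
have l0 : 0 <= l by exact: fine_ge0.
have nR : 0 < n%:R :> R by rewrite ltr0n.
have [g [N [mg mN N0 gO]]] := borel_representative n Omega intOmega homOmega.
pose M := C * n%:R * l.
have M0 : 0 <= M by rewrite !mulr_ge0// ltW.
have Hae := ae_osc_le n hn Omega g N mg mN N0 gO M M0.
have {}Hae := Hae _.
(* Hypothesis (3) at [delta = |w|] and [xi = w / |w|]. *)
have Hw w : 0 < enorm w < n%:R^-1 -> (\int[surface_measure n]_(x in unit_sphere n)
    `|Omega x - Omega (x + w)|%:E <= (M * enorm w)%:E)%E.
  move=> /[dup] wn /H; rewrite Ll -EFinM.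
  have -> : C * n%:R * enorm w * l = M * enorm w by rewrite /M; ring.
  apply: le_trans; apply: ereal_sup_ubound; exists (normalize w).
    by apply: enorm_normalize; rewrite -enorm_gt0; case/andP: wn.
  rewrite /normalize scalerA mulfV ?scale1r// gt_eqF//.
  by case/andP: wn.
have {}Hae := Hae Hw.
pose s : {finite_measure set 'rV[R]_n -> \bar R} := surface_borel n.
have s_rot (rho : 'M[R]_n) A : rotation rho -> measurable A ->
    s (mulmx^~ rho @^-1` A) = s A by exact: surface_borel_rotation.
pose K := M + 2 * M * (fine (lebesgue_rV_borel n (eball n (2 : R))) /
  fine (lebesgue_rV_borel n (eball n (1 : R)))).
have K0 : 0 <= K.
  apply: addr_ge0 => //; apply: mulr_ge0; first by lra.
  by apply: divr_ge0; exact: fine_ge0.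
have small delta : 0 < delta -> 2 * delta <= n%:R^-1 ->
    (l1_modulus Omega delta <= (K * delta)%:E)%E.
  move=> d0 dn; apply: le_l1_modulus => rho rot xd.
  rewrite (integral_rotation_representative n hn Omega g N)//.
  exact: (rotation_modulus_le n hn s s_rot g mg M n%:R^-1).
have large delta : (l1_modulus Omega delta <= (2 * l)%:E)%E.
  apply: le_l1_modulus => rho rot _.
  rewrite (integral_rotation_representative n hn Omega g N)//.
  rewrite EFinM -Ll /L (integral_norm_representative n Omega g N)//.
  exact: (rotation_difference_le n s g rho s_rot).
split => //.
(* If [2 delta <= 1 / n], then [omega_1 / delta <= K]. Otherwise [1 / delta < 2 n], and
   [omega_1 <= 2 l] gives at most [4 n l]. The sum of the two constants serves for both cases. *)
apply: (@le_lt_trans _ _ (\int[lebesgue_measure]_(delta in `]0%R, 1%R[)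
    (cst (K + 4 * n%:R * l)%:E delta))%E).
  apply: ge0_le_integral_nonmeas => delta /=; rewrite in_itv/= => /andP[d0 d1].
    by rewrite mule_ge0// ?lee_fin ?invr_ge0 ?(ltW d0)// l1_modulus_ge0// ltW.
  rewrite muleC lee_pdivrMl// -EFinM.
  have [dn|dn] := leP (2 * delta) n%:R^-1.
    apply: le_trans (small _ d0 dn) _; rewrite lee_fin mulrC ler_wpM2l ?(ltW d0)//.
    by rewrite lerDl !mulr_ge0// ltW.
  apply: le_trans (large delta) _; rewrite lee_fin.
  have : 1 < 2 * delta * n%:R by rewrite -ltr_pdivrMr// div1r.
  have := mulr_ge0 (ltW d0) K0; nra.
by rewrite integral_cst//= lebesgue_measure_itv/= lte01 -EFinB -EFinM ltry.
Qed.
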